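(* Let $\theta_0,\theta_1\in\mathbb{C}$ and let $a_0,b_0,c_0,c_1$ be holomorphic functions of $t$ on a connected open subset of $\mathbb{C}^*$ with $$a_0^2+b_0c_0=\frac{\theta_0^2}{4},\qquad a_0^2+(1+b_0)(c_0+c_1+t^2)=\frac{\theta_1^2}{4}.$$ Put $$A=A(z,t)=\frac{1}{z(z-1)}\begin{pmatrix}a_0&c_0+c_1z+t^2z^2\\ z+b_0&-a_0\end{pmatrix}$$ and suppose that the family $\frac{d}{dz}+A$ is isomonodromic in the sense that there is a trace zero $2\times2$ matrix $B=B(z,t)$, polynomial of degree $\le1$ in $z$ with coefficients holomorphic in $t$, such that $\frac{d}{dz}+A$ commutes with $\frac{d}{dt}+B$, i.e. $$\frac{\partial A}{\partial t}=\frac{\partial B}{\partial z}+[A,B].$$ Let $q=-b_0$ and assume that $q$ is not identically $0$ or $1$. Then, with ${}'=\frac{d}{dt}$, $$q''=\frac12\left(\frac1q+\frac1{q-1}\right)(q')^2-\frac{q'}{t}+\frac{2(q-1)\theta_0^2}{q\,t^2}-\frac{2q\,\theta_1^2}{(q-1)t^2}+8q(q-1).$$ Moreover, with $p=\frac t4q'$ and $$\mathcal H=\frac{2\left(p^2-\frac{\theta_0^2}{4}\right)}{tq}-\frac{2\left(p^2-\frac{\theta_1^2}{4}\right)}{t(q-1)}+2qt,$$ one has $q'=q(1-q)\frac{\partial\mathcal H}{\partial p}$ and $p'=-q(1-q)\frac{\partial\mathcal H}{\partial q}$.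
   Context: The displayed second-order equation is the degenerate fifth Painlevé equation $\mathrm{degP}_{\rm V}(\theta_0,\theta_1)$. The equations are understood as identities of meromorphic functions of $t$; $[A,B]=AB-BA$. The point $q=-b_0$ is the zero of the lower left entry of $z(z-1)A$. *)

(* Defs.v *)
From HB Require Import structures.
From mathcomp Require Import all_boot all_order all_algebra.
From mathcomp Require Import all_classical all_reals all_analysis.
From mathcomp Require Import complex.

Set Implicit Arguments.
Unset Strict Implicit.
Unset Printing Implicit Defensive.

Import Order.TTheory GRing.Theory Num.Theory numFieldNormedType.Exports.

Local Open Scope classical_set_scope.
Local Open Scope complex_scope.
Local Open Scope ring_scope.

(* The complex numbers R[i] as a normed space over themselves, so that
   [derivable f t 1] and [derive1 f t] are complex differentiability and the
   complex derivative. *)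
HB.instance Definition _ (R : realType) := NormedModule.copy R[i] R[i]^o.

Definition holomorphic (R : realType) (D : set R[i]) (f : R[i] -> R[i]) : Prop :=
  forall t, D t -> derivable f t 1.

(* Equality of the germs at every point of D.  For two meromorphic functions on
   D this is equality of meromorphic functions: the values at their poles,
   where Rocq's x / 0 = 0 intervenes, are ignored. *)
Definition meromorphic_eq (R : realType) (D : set R[i])
    (f g : R[i] -> R[i]) : Prop :=
  forall t0, D t0 -> \forall t \near t0^', f t = g t.

Definition mx2 (R : realType) (a b c d : R[i]) : 'M[R[i]]_2 :=
  \matrix_(i < 2, j < 2)
    if i == ord0 then (if j == ord0 then a else b)
    else (if j == ord0 then c else d).

Definition mx_derive (R : realType) (M : R[i] -> 'M[R[i]]_2) (s : R[i]) :
    'M[R[i]]_2 :=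
  \matrix_(i < 2, j < 2) derive1 (fun u => M u i j) s.

Definition commutator (R : realType) (A B : 'M[R[i]]_2) : 'M[R[i]]_2 :=
  A *m B - B *m A.

Definition connection (R : realType) (a0 b0 c0 c1 : R[i] -> R[i])
    (z t : R[i]) : 'M[R[i]]_2 :=
  (z * (z - 1))^-1 *:
    mx2 (a0 t)     (c0 t + c1 t * z + t ^+ 2 * z ^+ 2)
        (z + b0 t) (- a0 t).

(* B(z,t) = B0(t) + z B1(t).  The connection has its finite poles at z = 0
   and z = 1, so the identity of rational functions of z is imposed at the
   other points. *)
Definition isomonodromic (R : realType) (D : set R[i])
    (A : R[i] -> R[i] -> 'M[R[i]]_2) : Prop :=
  exists B0 B1 : R[i] -> 'M[R[i]]_2,
    let B z t := B0 t + z *: B1 t in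
    [/\ forall i j, holomorphic D (fun t => B0 t i j),
        forall i j, holomorphic D (fun t => B1 t i j),
        forall z t, D t -> \tr (B z t) = 0 &
        forall z t, D t -> z != 0 -> z != 1 ->
          mx_derive (fun s => A z s) t =
          mx_derive (fun w => B w t) z + commutator (A z t) (B z t)].

Definition hamiltonian (R : realType) (theta0 theta1 t q p : R[i]) : R[i] :=
  2 * (p ^+ 2 - theta0 ^+ 2 / 4) / (t * q)
  - 2 * (p ^+ 2 - theta1 ^+ 2 / 4) / (t * (q - 1))
  + 2 * q * t.

(* Main.v *)
Require Import Defs.
From HB Require Import structures.
From mathcomp Require Import all_boot all_order all_algebra.
From mathcomp Require Import all_classical all_reals all_analysis.
From mathcomp Require Import complex.
From mathcomp Require Import ring lra.

Set Implicit Arguments.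
Unset Strict Implicit.
Unset Printing Implicit Defensive.

Import Order.TTheory GRing.Theory Num.Theory numFieldNormedType.Exports.

Local Open Scope classical_set_scope.
Local Open Scope complex_scope.
Local Open Scope ring_scope.

(** Comparing coefficients of powers of z in the zero-curvature equation
    determines B: its diagonal vanishes, its lower left entry is 2/t and its
    upper right entry is 2tz + (2/t)(c1 - t^2 b0).  What remains of the equation
    is the differential system [deformation_system]; in particular
    q' = 4 a0 / t, so p is the entry a0.  The two determinant relations express
    c0 and c1 through a0, b0 and t wherever b0 and 1 + b0 do not vanish, and
    then a0' becomes a rational function of t, q and p ([momentum_derivative]).
    The second-order equation and the Hamiltonian system are now rational
    identities.

    These identities hold near every point of D, that point possibly excepted,
    because b0 and 1 + b0 have isolated zeros, and this comes from the
    differential system itself ([linear_system_zeros_isolated]).  The triples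
    (a0, b0, c0) and (a0, 1 + b0, c0 + c1 + t^2) are solutions (x, y, w) of
    linear homogeneous systems x' = al w + be y, y' = ga x, w' = de x with al
    and ga zero-free, and x^2 + y w is constant.  If such a triple vanished at
    one point, it would vanish identically, by uniqueness for linear equations
    ([linear_ode_unique], a Gronwall estimate along segments) and connectedness
    of D; this contradicts the assumption on q.  So at a zero of y there are two
    cases.  If x <> 0, then the zero of y is simple.  If x = 0, then w <> 0, so
    that x has a simple zero; the constant x^2 + y w being 0, every zero of y is
    a zero of x, and the zero of y is isolated as well. *)

(** * Complex derivatives of explicit functions *)

Section Calculus.
Variables (R : realType).
Implicit Types (f g : R[i] -> R[i]) (t : R[i]).

Lemma is_derive_add f g t df dg :
  is_derive t 1 f df -> is_derive t 1 g dg ->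
  is_derive t 1 (fun s => f s + g s) (df + dg).
Proof. exact: is_deriveD. Qed.

Lemma is_derive_opp f t df :
  is_derive t 1 f df -> is_derive t 1 (fun s => - f s) (- df).
Proof. exact: is_deriveN. Qed.

Lemma is_derive_mul f g t df dg :
  is_derive t 1 f df -> is_derive t 1 g dg ->
  is_derive t 1 (fun s => f s * g s) (f t * dg + g t * df).
Proof. exact: is_deriveM. Qed.

Lemma is_derive_inv f t df : f t != 0 ->
  is_derive t 1 f df -> is_derive t 1 (fun s => (f s)^-1) (- (f t ^- 2) * df).
Proof.
move=> f0 [fd <-]; split; first exact: derivableV.
exact: deriveV.
Qed.

Lemma is_derive1 f t df : is_derive t 1 f df -> derive1 f t = df.
Proof. by move=> fd; rewrite derive1E derive_val. Qed.

Lemma derivable_is_derive f t :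
  derivable f t 1 -> is_derive t 1 f (derive1 f t).
Proof. by move=> fd; rewrite derive1E; exact: derivableP. Qed.

Lemma is_derive_continuous f t df : is_derive t 1 f df -> {for t, continuous f}.
Proof.
by move=> [fd _]; apply: differentiable_continuous; exact/derivable1_diffP.
Qed.

Lemma near_derive1 f g t :
  (\forall s \near t, f s = g s) -> derive1 f t = derive1 g t.
Proof. by move=> fg; rewrite !derive1E; exact: near_eq_derive. Qed.

Lemma near_neq0 f t :
  {for t, continuous f} -> f t != 0 -> \forall s \near t, f s != 0.
Proof.
move=> fc f0; apply: (fc [set z | z != 0]).
exists `|f t| => /=; first by rewrite normr_gt0.
by move=> y /=; apply: contraTneq => ->; rewrite subr0 ltxx.
Qed.

Lemma isolated_zero f t df :
  is_derive t 1 f df -> f t = 0 -> df != 0 -> \forall s \near t^', f s != 0.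
Proof.
move=> [fd <-] f0 d0.
have : (fun h => h^-1 *: (f (h *: 1 + t) - f t)) @ 0^' --> 'D_1 f t by exact: fd.
move=> /(_ [set z | z != 0]) [].
  exists `|'D_1 f t| => /=; first by rewrite normr_gt0.
  by move=> y /=; apply: contraTneq => ->; rewrite subr0 ltxx.
move=> e /= e0 He; exists e => // s /= ste sneq.
have := He (s - t); rewrite /= sub0r normrN distrC subr_eq0 => /(_ ste sneq).
rewrite f0 subr0 [_ *: 1]mulr1 subrK.
by apply: contra_neq => ->; rewrite scaler0.
Qed.

End Calculus.

(** * Uniqueness for linear differential equations in the complex domain *)

Local Notation normc := ComplexField.Normc.normc.

Section Segment.
Variable R : realType.

(** Taking real parts turns a complex difference quotient along a real
    parameter into a real one. *)
Lemma Re_is_derive (f : R -> R[i]) (d : R[i]) (s : R) :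
  (fun h : R => (h^-1)%:C * (f (h + s) - f s)) @ 0^' --> d ->
  is_derive s (1 : R) (fun u => complex.Re (f u)) (complex.Re d).
Proof.
move=> fd.
have H : (fun h : R => h^-1 *: (complex.Re (f (h *: 1 + s)) - complex.Re (f s)))
    @ 0^' --> complex.Re d.
  apply/cvgrPdist_lt => e e0.
  move/cvgrPdist_lt : fd => /(_ e%:C); rewrite ltcR => /(_ e0).
  apply: filterS => h; rewrite -ltcR; apply: le_lt_trans.
  rewrite [h *: 1]mulr1.
  apply: le_trans (normc_ge_Re _); rewrite lecR.
  case: (d) (f (h+s)) (f s) => [d1 d2] [x1 x2] [y1 y2] /=.
  by rewrite /GRing.scale /= mul0r subr0.
by split; [apply/cvg_ex; exists (complex.Re d)| exact: cvg_lim].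
Qed.

Lemma norm_normc (z : R[i]) : `|z| = (normc z)%:C.
Proof. by []. Qed.

Definition sqn (z : R[i]) : R := complex.Re z ^+ 2 + complex.Im z ^+ 2.

Lemma sqnE z : sqn z = normc z ^+ 2.
Proof.
by case: z => a b; rewrite /sqn /= sqr_sqrtr // addr_ge0 ?sqr_ge0.
Qed.

Lemma normc_ge0 (z : R[i]) : 0 <= normc z.
Proof. by case: z => a b; exact: sqrtr_ge0. Qed.

(** The factor c allows both the real part (c = 1) and the imaginary part
    (c = - i) of f to be read off; the step h may be 0. *)
Lemma is_derive_segment (f : R[i] -> R[i]) (d t0 h c : R[i]) (s : R) :
  is_derive (t0 + s%:C * h) 1 f d ->
  is_derive s (1 : R) (fun u => complex.Re (c * f (t0 + u%:C * h)))
    (complex.Re (c * (h * d))).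
Proof.
move=> [fd <-]; apply: Re_is_derive.
have [->|h0] := eqVneq h 0.
  rewrite mul0r mulr0 (_ : (fun _ : R => _) = cst 0); first exact: cvg_cst.
  by apply/funext => k; rewrite !mulr0 subrr mulr0.
set a := t0 + s%:C * h.
have fda : (fun k => k^-1 *: (f (k *: 1 + a) - f a)) @ 0^' --> 'D_1 f a by exact: fd.
have kh : (fun k : R => k%:C * h) @ 0^' --> 0^'.
  move=> A [e /= e0 He].
  have nh0 : 0 < normc h by rewrite -ltcR -norm_normc normr_gt0.
  have er : e = (complex.Re e)%:C by rewrite RRe_real // gtr0_real.
  exists (complex.Re e / normc h) => /=.
    by rewrite divr_gt0 // -ltcR -er.
  move=> k /= ke k0; apply: He => /=.
    move: ke; rewrite !sub0r !normrN ltr_pdivlMr // -ltcR -er; apply: le_lt_trans.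
    rewrite normrM (norm_normc h) rmorphM /= ler_wpM2r ?ler0c ?normc_ge0 //.
    by rewrite normc_def /= expr0n addr0 sqrtr_sqr.
  by rewrite mulf_neq0 //; apply: contra_neq k0 => /complexI.
have lim := cvgM (cvg_cst (c * h)) (cvg_comp _ _ kh fda).
rewrite [X in _ --> X]mulrA; apply: (cvg_trans _ (lim _ _)).
apply: near_eq_cvg.
near=> k => /=.
have k0 : k%:C != 0 :> R[i].
  have : k != 0 by near: k; exact: nbhs_dnbhs_neq.
  by apply: contra_neq => /complexI.
rewrite [_ *: 1]mulr1 /GRing.scale /= fmorphV.
rewrite rmorphD /= (_ : t0 + (k%:C + s%:C) * h = k%:C * h + a); last first.
  by rewrite /a; ring.
by rewrite -/a; field; rewrite k0 h0.
Unshelve. all: by end_near. Qed.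

(** The function exp (- K s) E s is nonincreasing. *)
Lemma gronwall_zero (E dE : R -> R) (K : R) :
  (forall s : R, s \in `[0, 1]%R -> is_derive s (1 : R) E (dE s)) ->
  (forall s : R, s \in `[0, 1]%R -> dE s <= K * E s) ->
  E 0 = 0 -> E 1 <= 0.
Proof.
move=> Ed dEle E0.
pose F s := expR (- K * s) * E s.
have Fd (s : R) : s \in `[0, 1]%R ->
    is_derive s (1 : R) F (expR (- K * s) * (dE s - K * E s)).
  move=> s01; have Eds := Ed s s01.
  have ed : is_derive s (1 : R) (fun u => expR (- K * u)) (- K * expR (- K * s)).
    have Kd : is_derive s (1 : R) (fun u : R => - K * u) (- K *: 1).
      exact: is_deriveZ.
    have := @is_derive1_comp R expR (fun u => - K * u) s _ _ (is_derive_expR _) Kd.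
    by rewrite [_ *: 1]mulr1 mulrC.
  apply: (is_derive_eq (is_deriveM ed Eds)).
  by rewrite /GRing.scale /=; ring.
have sub (s : R) : s \in `]0, 1[%R -> s \in `[0, 1]%R.
  by apply: subset_itv_oo_cc.
have : F 1 <= F 0.
  apply: (@ler0_derive1_nincr _ F 0 1) => //.
  - by move=> s /sub /Fd [].
  - move=> s /sub s01; have := Fd s s01 => Fds; rewrite derive1E derive_val.
    by rewrite mulr_ge0_le0 ?expR_ge0 // subr_le0 dEle.
  - apply: derivable_within_continuous => s s01.
    by have [] := Fd s s01.
by rewrite /F E0 mulr0 pmulr_rle0 // expR_gt0.
Qed.

Lemma is_derive_sqn_segment (f : R[i] -> R[i]) (d t0 h : R[i]) (s : R) :
  is_derive (t0 + s%:C * h) 1 f d ->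
  is_derive s (1 : R) (fun u => sqn (f (t0 + u%:C * h)))
    (2 * complex.Re ((f (t0 + s%:C * h))^* * (h * d))).
Proof.
move=> fd.
have fr := is_derive_segment 1 fd.
have fi := is_derive_segment (- 'i) fd.
have -> : (fun u : R => sqn (f (t0 + u%:C * h))) =
   (fun u : R => complex.Re (1 * f (t0 + u%:C * h)))^+2 +
   (fun u : R => complex.Re (- 'i * f (t0 + u%:C * h)))^+2.
  apply/funext => u; rewrite !fctE /sqn mul1r.
  by case: (f _) => a b /=; simpc; rewrite ?oppr0 ?mul0r ?mulN1r ?opprK ?add0r.
apply: (is_derive_eq (is_deriveD (is_deriveX 2 fr) (is_deriveX 2 fi))).
case: (f _) (h * d) => [a b] [m n] /=; rewrite /GRing.scale /=; ring.
Qed.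

Lemma sqn_derive_le (z d h : R[i]) :
  2 * complex.Re (z^* * (h * d)) <= 2 * (normc h * normc z * normc d).
Proof.
rewrite ler_pM2l //.
apply: (le_trans (ler_norm _)); rewrite -lecR.
apply: (le_trans (normc_ge_Re _)).
by rewrite !normrM normcJ (norm_normc z) (norm_normc h) (norm_normc d) -!rmorphM /= lecR
  mulrA [normc z * _]mulrC.
Qed.

(** On the segment from t0 to t, parametrized by [0, 1], the energy
    E = |x|^2 + |y|^2 + |w|^2 starts at 0 and satisfies E' <= 6 |t - t0| M E,
    since (a + b + c)^2 <= 3 (a^2 + b^2 + c^2). *)
Lemma linear_ode_unique (x y w dx dy dw : R[i] -> R[i]) (t0 : R[i]) (M : R) :
  0 <= M ->
  (\forall t \near t0,
     [/\ is_derive (t : R[i]) 1 x (dx t), is_derive t 1 y (dy t) &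
         is_derive t 1 w (dw t)]) ->
  (\forall t \near t0,
     let N := normc (x t) + normc (y t) + normc (w t) in
     [/\ normc (dx t) <= M * N, normc (dy t) <= M * N &
         normc (dw t) <= M * N]) ->
  x t0 = 0 -> y t0 = 0 -> w t0 = 0 ->
  \forall t \near t0, [/\ x t = 0, y t = 0 & w t = 0].
Proof.
move=> M0 near_d near_le x0 y0 w0.
have [e /= e0 He] := filterI near_d near_le.
exists e => // t /= t0t; pose h := t - t0.
have seg (s : R) : s \in `[0, 1]%R -> ball t0 e (t0 + s%:C * h).
  rewrite in_itv /= => /andP[s0 s1].
  rewrite -ball_normE /ball_ /= opprD addrA subrr sub0r normrN normrM.
  rewrite ger0_norm ?ler0c // (le_lt_trans _ t0t) // /h distrC.
  by rewrite ler_piMl // (_ : 1 = 1%:C) // lecR.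
pose E (s : R) := sqn (x (t0 + s%:C * h)) + sqn (y (t0 + s%:C * h))
  + sqn (w (t0 + s%:C * h)).
pose q (f df : R[i] -> R[i]) (s : R) :=
  2 * complex.Re ((f (t0 + s%:C * h))^* * (h * df (t0 + s%:C * h))).
pose dE s := q x dx s + q y dy s + q w dw s.
have E1 : E 1 <= 0.
  apply: (@gronwall_zero E dE (6 * normc h * M)).
  - move=> s s01; have [[xd yd wd] _] := He _ (seg s s01).
    exact: (is_deriveD (is_deriveD (is_derive_sqn_segment xd)
      (is_derive_sqn_segment yd)) (is_derive_sqn_segment wd)).
  - move=> s s01; have [_ /=] := He _ (seg s s01).
    rewrite /dE /q /E !sqnE; set z := t0 + _.
    move=> [xle yle wle].
    have := sqn_derive_le (x z) (dx z) h.
    have := sqn_derive_le (y z) (dy z) h.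
    have := sqn_derive_le (w z) (dw z) h.
    move: xle yle wle (normc_ge0 (x z)) (normc_ge0 (y z)) (normc_ge0 (w z)).
    move: (normc_ge0 h).
    move: (normc (x z)) (normc (y z)) (normc (w z)) (normc h) => a b c n.
    move: (normc (dx z)) (normc (dy z)) (normc (dw z)) => a' b' c'.
    move: (complex.Re _) (complex.Re _) (complex.Re _) => r1 r2 r3.
    move=> n0 ha hb hc a0 b0 c0 h3 h2 h1.
    have k1 := ler_wpM2l (mulr_ge0 n0 a0) ha.
    have k2 := ler_wpM2l (mulr_ge0 n0 b0) hb.
    have k3 := ler_wpM2l (mulr_ge0 n0 c0) hc.
    have nM := mulr_ge0 n0 M0.
    have k4 : n * M * ((a + b + c) ^+ 2) <= n * M * (3 * (a ^+ 2 + b ^+ 2 + c ^+ 2)).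
      apply: ler_wpM2l => //.
      have := sqr_ge0 (a - b); have := sqr_ge0 (b - c); have := sqr_ge0 (a - c).
      nra.
    lra.
  - by rewrite /E /sqn mul0r addr0 x0 y0 w0 /= !expr0n /= !addr0.
move: E1; rewrite /E mul1r /h (addrC t0) subrK !sqnE => E1.
have z1 := sqr_ge0 (normc (x t)); have z2 := sqr_ge0 (normc (y t)).
have z3 := sqr_ge0 (normc (w t)).
split; apply: ComplexField.Normc.eq0_normc; apply/eqP; rewrite -sqrf_eq0;
  apply/eqP; lra.
Qed.

Lemma near_normc_le (f : R[i] -> R[i]) (t : R[i]) : {for t, continuous f} ->
  \forall s \near t, normc (f s) <= normc (f t) + 1.
Proof.
move=> fc; have /cvgrPdist_le /(_ 1 ltr01) := fc.
apply: filterS => s; rewrite distrC norm_normc (_ : 1 = 1%:C) // lecR => le1.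
have := ler_normD (f s - f t) (f t).
by rewrite subrK !norm_normc -rmorphD lecR => le2; lra.
Qed.

End Segment.

(** * Isolated zeros *)

(** The common zeros of x, y and w form an open set by uniqueness and a
    relatively closed one by continuity, hence there are none unless y
    vanishes on D.  At a zero of y the invariant x^2 + y w and the
    non-vanishing of al and ga then exclude accumulation of zeros. *)
Lemma linear_system_zeros_isolated (R : realType) (D : set R[i])
    (x y w al be ga de : R[i] -> R[i]) (k : R[i]) :
  open D -> connected D ->
  (forall t, D t -> is_derive t 1 x (al t * w t + be t * y t)) ->
  (forall t, D t -> is_derive t 1 y (ga t * x t)) ->
  (forall t, D t -> is_derive t 1 w (de t * x t)) ->
  (forall t, D t -> [/\ {for t, continuous al}, {for t, continuous be},
                        {for t, continuous ga} & {for t, continuous de}]) ->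
  (forall t, D t -> al t != 0) -> (forall t, D t -> ga t != 0) ->
  (forall t, D t -> x t ^+ 2 + y t * w t = k) ->
  ~ (forall t, D t -> y t = 0) ->
  forall t0, D t0 -> \forall t \near t0^', y t != 0.
Proof.
move=> Do Dc xd yd wd coefc al0 ga0 inv ynz t0 Dt0.
have nearD t : D t -> \forall s \near t, D s by move=> Dt; exact: open_nbhs_nbhs.
pose Z := [set t | D t /\ [/\ x t = 0, y t = 0 & w t = 0]].
have Zopen t : Z t -> \forall s \near t, Z s.
  move=> [Dt [x0 y0 w0]]; have [ac bc gc dc] := coefc t Dt.
  set M := (normc (al t) + 1) + (normc (be t) + 1) + (normc (ga t) + 1)
    + (normc (de t) + 1).
  have n0 (f : R[i] -> R[i]) s : 0 <= normc (f s) by exact: normc_ge0.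
  have M0 : 0 <= M by rewrite /M !addr_ge0.
  have := @linear_ode_unique R x y w (fun t => al t * w t + be t * y t)
    (fun t => ga t * x t) (fun t => de t * x t) t M M0 _ _ x0 y0 w0.
  move=> /(_ _ _)/wrap[].
  - by apply: filterS (nearD t Dt) => s Ds; split; [exact: xd|exact: yd|exact: wd].
  - near=> s => /=.
    have ale : normc (al s) <= normc (al t) + 1 by near: s; exact: near_normc_le.
    have ble : normc (be s) <= normc (be t) + 1 by near: s; exact: near_normc_le.
    have gle : normc (ga s) <= normc (ga t) + 1 by near: s; exact: near_normc_le.
    have dle : normc (de s) <= normc (de t) + 1 by near: s; exact: near_normc_le.
    have := ler_normD (al s * w s) (be s * y s).
    rewrite !normrM !norm_normc -!rmorphM -rmorphD lecR => tri.
    rewrite !ComplexField.Normc.normcM.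
    have a0 := n0 al s; have b0 := n0 be s; have g0 := n0 ga s.
    have d0 := n0 de s; have xs0 := n0 x s; have ys0 := n0 y s.
    have ws0 := n0 w s.
    have ta0 := n0 al t; have tb0 := n0 be t; have tg0 := n0 ga t.
    have td0 := n0 de t.
    have aM : normc (al s) <= M by rewrite /M; lra.
    have bM : normc (be s) <= M by rewrite /M; lra.
    have gM : normc (ga s) <= M by rewrite /M; lra.
    have dM : normc (de s) <= M by rewrite /M; lra.
    have k1 := ler_wpM2r ws0 aM; have k2 := ler_wpM2r ys0 bM.
    have k3 := ler_wpM2r xs0 gM; have k4 := ler_wpM2r xs0 dM.
    have Mx := mulr_ge0 M0 xs0; have My := mulr_ge0 M0 ys0.
    have Mw := mulr_ge0 M0 ws0.
    by split; lra.
  - by apply: filterS2 (nearD t Dt) => s Ds Zs; split.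
have Zempty t : D t -> Z t -> False.
  move=> Dt Zt; apply: ynz => s Ds.
  suff ZD : Z = D by have : Z s by [rewrite ZD]; case=> _ [].
  apply: (Dc Z); first by exists t.
  - exists Z; last by apply/seteqP; split=> u; [move=> [] | case].
    by rewrite openE => u; exact: Zopen.
  - exists (closure Z); first exact: closed_closure.
    apply/seteqP; split=> [u Zu|u [Du clZ]].
      by split; [case: Zu|exact: subset_closure].
    have vanish (f : R[i] -> R[i]) df : is_derive u 1 f df ->
        (forall v, Z v -> f v = 0) -> f u = 0.
      move=> /is_derive_continuous fc fZ; apply/eqP/negP => /negP fu.
      by have /clZ [v [Zv /=]] := near_neq0 fc fu; rewrite (fZ v Zv) eqxx.
    split=> //; split; [apply: (vanish _ _ (xd u Du))|
      apply: (vanish _ _ (yd u Du))|apply: (vanish _ _ (wd u Du))];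
      by move=> v [_ []].
have [yt0|/eqP yt0] := eqVneq (y t0) 0; last first.
  by apply/nbhs_dnbhs/near_neq0; [exact: is_derive_continuous (yd t0 Dt0)|exact/eqP].
have [xt0|xt0] := eqVneq (x t0) 0; last first.
  by apply: (isolated_zero (yd t0 Dt0)) => //; rewrite mulf_neq0 ?ga0.
have k0 : k = 0 by rewrite -(inv t0 Dt0) xt0 yt0 expr0n mul0r addr0.
have wt0 : w t0 != 0.
  by apply/eqP => wt0; exact: (Zempty t0).
(* Now k = 0: near t0 every zero of y is a zero of x. *)
have : \forall t \near t0^', x t != 0.
  apply: (isolated_zero (xd t0 Dt0)) => //.
  by rewrite yt0 mulr0 addr0 mulf_neq0 ?al0.
apply: filterS2 (nbhs_dnbhs (nearD t0 Dt0)) => t Dt.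
apply: contra_neq => yt; have := inv t Dt.
by rewrite yt mul0r addr0 k0 => /eqP; rewrite sqrf_eq0 => /eqP.
Unshelve. all: by end_near. Qed.

(** * The equations of isomonodromic deformation *)

(** The numbers 2, 3, 4, 5 are four roots of a polynomial of degree at most 3. *)
Lemma cubic_eq0 (F : numFieldType) (k0 k1 k2 k3 : F) :
  (forall z, z != 0 -> z != 1 -> k0 + k1 * z + k2 * z ^+ 2 + k3 * z ^+ 3 = 0) ->
  [/\ k0 = 0, k1 = 0, k2 = 0 & k3 = 0].
Proof.
move=> cub; pose s := [:: k0; k1; k2; k3].
have P0 : Poly s = 0.
  apply: (@roots_geq_poly_eq0 _ _ [seq n%:R | n <- iota 2 4]).
  - apply/allP => z /mapP[n]; rewrite mem_iota => /andP[n2 _] ->.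
    rewrite /root horner_Poly /= -[X in _ == X](cub n%:R).
    + by apply/eqP; ring.
    + by rewrite pnatr_eq0 -lt0n (leq_trans _ n2).
    + by rewrite pnatr_eq1 gtn_eqF.
  - by rewrite map_inj_uniq ?iota_uniq // => m n /eqP; rewrite eqr_nat => /eqP.
  - by rewrite size_map size_iota (leq_trans (size_Poly s)).
have coef i : s`_i = 0 by rewrite -(coef_Poly s) P0 coef0.
by split; [exact: (coef 0)|exact: (coef 1)|exact: (coef 2)|exact: (coef 3)].
Qed.

(** With B = [[al, be], [ga, - al]], each entry affine in z, the hypotheses are
    the upper left, lower left and upper right entries of the zero-curvature
    equation multiplied by z (z - 1).  Their higher coefficients give
    successively ga1 = al1 = al0 = 0, be1 = 2 t, ga0 = 2 / t and
    be0 = (2 / t) (c1 - t^2 b); the remaining ones are the conclusion. *)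
Lemma zero_curvature_coefficients (F : numFieldType)
    (t a b c0 c1 da db dc0 dc1 al0 al1 be0 be1 ga0 ga1 : F) :
  t != 0 ->
  (forall z, z != 0 -> z != 1 ->
     da = z * (z - 1) * al1
       + ((c0 + c1 * z + t ^+ 2 * z ^+ 2) * (ga0 + z * ga1)
          - (be0 + z * be1) * (z + b))) ->
  (forall z, z != 0 -> z != 1 ->
     db = z * (z - 1) * ga1
       + 2 * ((z + b) * (al0 + z * al1) - a * (ga0 + z * ga1))) ->
  (forall z, z != 0 -> z != 1 ->
     dc0 + dc1 * z + 2 * t * z ^+ 2 = z * (z - 1) * be1
       + 2 * (a * (be0 + z * be1)
              - (c0 + c1 * z + t ^+ 2 * z ^+ 2) * (al0 + z * al1))) ->
  [/\ da = 2 / t * (c0 - b * c1 + t ^+ 2 * b ^+ 2),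
      db = - 4 / t * a,
      dc0 = 4 / t * (c1 - t ^+ 2 * b) * a &
      dc1 = 4 * t * a - 2 * t].
Proof.
move=> t0 eq00 eq10 eq01.
have [e0 e1 e2 e3] : [/\ c0 * ga0 - be0 * b - da = 0,
    c0 * ga1 + c1 * ga0 - be0 - be1 * b - al1 = 0,
    c1 * ga1 + t ^+ 2 * ga0 - be1 + al1 = 0 & t ^+ 2 * ga1 = 0].
  by apply: cubic_eq0 => z z0 z1; rewrite (eq00 z z0 z1); ring.
have [f0 f1 f2 _] : [/\ 2 * al0 * b - 2 * a * ga0 - db = 0,
    2 * al0 + 2 * al1 * b - 2 * a * ga1 - ga1 = 0,
    ga1 + 2 * al1 = 0 & 0 = 0 :> F].
  by apply: cubic_eq0 => z z0 z1; rewrite (eq10 z z0 z1); ring.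
have [g0 g1 g2 _] : [/\ 2 * a * be0 - 2 * al0 * c0 - dc0 = 0,
    2 * a * be1 - 2 * al0 * c1 - 2 * al1 * c0 - be1 - dc1 = 0,
    be1 - 2 * al0 * t ^+ 2 - 2 * al1 * c1 - 2 * t = 0
    & - 2 * al1 * t ^+ 2 = 0].
  apply: cubic_eq0 => z z0 z1.
  rewrite -[RHS](subrr (dc0 + dc1 * z + 2 * t * z ^+ 2)).
  by rewrite [X in _ = X - _](eq01 z z0 z1); ring.
have two0 : 2 != 0 :> F by rewrite pnatr_eq0.
have ga1E : ga1 = 0.
  by move/eqP: e3; rewrite mulf_eq0 sqrf_eq0 (negPf t0) => /eqP.
have al1E : al1 = 0.
  by move/eqP: f2; rewrite ga1E add0r mulf_eq0 (negPf two0) => /eqP.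
have al0E : al0 = 0.
  move/eqP: f1; rewrite ga1E al1E !(mulr0, mul0r, addr0, subr0).
  by rewrite mulf_eq0 (negPf two0) => /eqP.
have be1E : be1 = 2 * t.
  by move: g2; rewrite al0E al1E !(mulr0, mul0r, subr0) => /subr0_eq.
have ga0E : ga0 = 2 / t.
  move: e2; rewrite ga1E al1E be1E mulr0 add0r addr0 => /subr0_eq E.
  by apply: (mulfI (expf_neq0 2 t0)); rewrite E; field.
have be0E : be0 = 2 / t * (c1 - t ^+ 2 * b).
  move: e1; rewrite ga1E al1E be1E ga0E mulr0 add0r subr0 addrAC => /subr0_eq <-.
  by field.
split.
- by rewrite -(subr0_eq e0) ga0E be0E; ring.
- by rewrite -(subr0_eq f0) ga0E al0E; ring.
- by rewrite -(subr0_eq g0) be0E al0E; ring.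
- by rewrite -(subr0_eq g1) be1E al0E al1E; ring.
Qed.

Section ZeroCurvature.
Variable R : realType.

Lemma mx2P (a b c d : R[i]) (M : 'M[R[i]]_2) :
  M 0 0 = a -> M 0 1 = b -> M 1 0 = c -> M 1 1 = d -> M = mx2 a b c d.
Proof.
move=> <- <- <- <-; apply/matrixP => i j; rewrite mxE.
by case: i j => [[|[|//]] ?] [[|[|//]] ?] /=; congr (M _ _); exact: val_inj.
Qed.

Lemma mx2E (a b c d : R[i]) :
  (mx2 a b c d 0 0 = a) * (mx2 a b c d 0 1 = b) *
  (mx2 a b c d 1 0 = c) * (mx2 a b c d 1 1 = d).
Proof. by rewrite !mxE. Qed.

Lemma commutator_traceless (a b c al be ga : R[i]) :
  commutator (mx2 a b c (- a)) (mx2 al be ga (- al)) =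
  mx2 (b * ga - be * c) (2 * (a * be - b * al))
      (2 * (c * al - a * ga)) (be * c - b * ga).
Proof.
have lift1 : lift ord0 ord0 = 1 :> 'I_2 by exact: val_inj.
have mul2 (M N : 'M[R[i]]_2) i j : (M *m N) i j = M i 0 * N 0 j + M i 1 * N 1 j.
  by rewrite mxE !big_ord_recl big_ord0 lift1 addr0.
by apply: mx2P; rewrite /commutator mxE [X in _ + X]mxE !mul2 !mx2E; ring.
Qed.

Lemma mul_derive1 (k : R[i]) (f : R[i] -> R[i]) (t df : R[i]) :
  k != 0 -> is_derive t 1 f df -> k * derive1 (fun s => k^-1 * f s) t = df.
Proof.
by move=> k0 fd; rewrite (is_derive1 (is_deriveZ k^-1 fd)) mulVKf.
Qed.

Definition deformation_system (a0 b0 c0 c1 : R[i] -> R[i]) (t : R[i]) : Prop :=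
  [/\ is_derive t 1 a0 (2 / t * (c0 t - b0 t * c1 t + t ^+ 2 * b0 t ^+ 2)),
      is_derive t 1 b0 (- 4 / t * a0 t),
      is_derive t 1 c0 (4 / t * (c1 t - t ^+ 2 * b0 t) * a0 t) &
      is_derive t 1 c1 (4 * t * a0 t - 2 * t)].

Lemma isomonodromic_deformation_system (D : set R[i]) (a0 b0 c0 c1 : R[i] -> R[i]) :
  (forall t, D t -> t != 0) ->
  holomorphic D a0 -> holomorphic D b0 -> holomorphic D c0 -> holomorphic D c1 ->
  isomonodromic D (connection a0 b0 c0 c1) ->
  forall t, D t ->
  deformation_system a0 b0 c0 c1 t.
Proof.
move=> Dn0 ha hb hc0 hc1 [B0 [B1 [_ _ trB flat]]] t Dt.
have da := derivable_is_derive (ha t Dt).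
have db := derivable_is_derive (hb t Dt).
have dc0 := derivable_is_derive (hc0 t Dt).
have dc1 := derivable_is_derive (hc1 t Dt).
have BE z : B0 t + z *: B1 t =
    mx2 (B0 t 0 0 + z * B1 t 0 0) (B0 t 0 1 + z * B1 t 0 1)
        (B0 t 1 0 + z * B1 t 1 0) (- (B0 t 0 0 + z * B1 t 0 0)).
  apply: mx2P; rewrite ?mxE //; apply/eqP; rewrite -addr_eq0; apply/eqP.
  rewrite [LHS]addrC -(trB z t Dt) /mxtrace !big_ord_recl big_ord0 !mxE addr0.
  by rewrite (_ : lift ord0 ord0 = 1) //; exact: val_inj.
have dB z i j : derive1 (fun w => (B0 t + w *: B1 t) i j) z = B1 t i j.
  have -> : (fun w => (B0 t + w *: B1 t) i j) = (fun w => B0 t i j + w * B1 t i j).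
    by apply/funext => w; rewrite !mxE.
  apply: is_derive1; apply: (is_derive_eq (is_derive_add
    (is_derive_cst (B0 t i j) z 1)
    (is_derive_mul (is_derive_id z 1) (is_derive_cst (B1 t i j) z 1)))).
  by rewrite mulr0 mulr1 !add0r.
have entry z i j (f : R[i] -> R[i]) df : z != 0 -> z != 1 ->
    (forall s, connection a0 b0 c0 c1 z s i j = (z * (z - 1))^-1 * f s) ->
    is_derive t 1 f df ->
    df = z * (z - 1) * B1 t i j +
      commutator (mx2 (a0 t) (c0 t + c1 t * z + t ^+ 2 * z ^+ 2)
                      (z + b0 t) (- a0 t)) (B0 t + z *: B1 t) i j.
  move=> z0 z1 fE fd; have P0 : z * (z - 1) != 0 by rewrite mulf_neq0 // subr_eq0.
  rewrite -(mul_derive1 P0 fd) -(funext fE).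
  have /matrixP/(_ i j) := flat z t Dt z0 z1.
  rewrite [LHS]mxE [RHS]mxE [X in X + _]mxE dB => ->.
  rewrite mulrDr /commutator /connection -scalemxAl -scalemxAr -scalerBr.
  by rewrite [X in _ + _ * X = _]mxE mulVKf.
have [||||Ea Eb Ec0 Ec1] := @zero_curvature_coefficients _ t (a0 t) (b0 t)
    (c0 t) (c1 t) (derive1 a0 t) (derive1 b0 t) (derive1 c0 t) (derive1 c1 t)
    (B0 t 0 0) (B1 t 0 0) (B0 t 0 1) (B1 t 0 1) (B0 t 1 0) (B1 t 1 0).
- exact: Dn0.
- move=> z z0 z1; rewrite [LHS](entry z 0 0 _ _ z0 z1 _ da).
    by rewrite BE commutator_traceless mx2E.
  by move=> s; rewrite !mxE.
- move=> z z0 z1.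
  have db' : is_derive t 1 (fun s => z + b0 s) (derive1 b0 t).
    by apply: (is_derive_eq (is_derive_add (is_derive_cst z t 1) db)); rewrite add0r.
  rewrite [LHS](entry z 1 0 _ _ z0 z1 _ db').
    by rewrite BE commutator_traceless mx2E.
  by move=> s; rewrite !mxE.
- move=> z z0 z1.
  have dc' : is_derive t 1 (fun s => c0 s + c1 s * z + s ^+ 2 * z ^+ 2)
      (derive1 c0 t + derive1 c1 t * z + 2 * t * z ^+ 2).
    apply: (is_derive_eq (is_derive_add (is_derive_add dc0
      (is_derive_mul dc1 (is_derive_cst z t 1)))
      (is_derive_mul (is_derive_mul (is_derive_id t 1) (is_derive_id t 1))
         (is_derive_cst (z ^+ 2) t 1)))).
    rewrite /= !mulr0 !mulr1 !add0r.
    by rewrite [z * _]mulrC [z ^+ 2 * _]mulrC -mulr2n mulr_natl.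
  rewrite [LHS](entry z 0 1 _ _ z0 z1 _ dc').
    by rewrite BE commutator_traceless mx2E.
  by move=> s; rewrite !mxE.
by split; [rewrite -Ea|rewrite -Eb|rewrite -Ec0|rewrite -Ec1].
Qed.
End ZeroCurvature.

(** The system is linear in (a0, b0, c0) once c1 is regarded as a coefficient. *)
Lemma b0_zeros_isolated (R : realType) (D : set R[i])
    (a0 b0 c0 c1 : R[i] -> R[i]) (k : R[i]) :
  open D -> connected D -> (forall t, D t -> t != 0) ->
  (forall t, D t -> deformation_system a0 b0 c0 c1 t) ->
  (forall t, D t -> a0 t ^+ 2 + b0 t * c0 t = k) ->
  ~ (forall t, D t -> b0 t = 0) ->
  forall t0, D t0 -> \forall t \near t0^', b0 t != 0.
Proof.
move=> Do Dc Dn0 deq inv.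
pose al (t : R[i]) := 2 / t; pose be t := 2 / t * (t ^+ 2 * b0 t - c1 t).
pose ga (t : R[i]) := - 4 / t; pose de t := 4 / t * (c1 t - t ^+ 2 * b0 t).
have ad t : D t -> is_derive t 1 a0 (al t * c0 t + be t * b0 t).
  move=> Dt; have [ad _ _ _] := deq t Dt; apply: (is_derive_eq ad).
  by rewrite /al /be -[X in _ = _ + X]mulrA -mulrDr; congr (_ * _); ring.
have bd t : D t -> is_derive t 1 b0 (ga t * a0 t) by move=> /deq[].
have cd t : D t -> is_derive t 1 c0 (de t * a0 t) by move=> /deq[].
have coefc t : D t -> [/\ {for t, continuous al}, {for t, continuous be},
                        {for t, continuous ga} & {for t, continuous de}].
  move=> Dt; have [_ bd' _ c1d] := deq t Dt.
  have divd m := is_derive_mul (is_derive_cst m t 1)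
    (is_derive_inv (Dn0 t Dt) (is_derive_id t 1)).
  have sqd := is_derive_mul (is_derive_id t 1) (is_derive_id t 1).
  have tbd := is_derive_mul sqd bd'.
  split.
  - exact: is_derive_continuous (divd 2).
  - exact: is_derive_continuous (is_derive_mul (divd 2)
      (is_derive_add tbd (is_derive_opp c1d))).
  - exact: is_derive_continuous (divd (- 4)).
  - exact: is_derive_continuous (is_derive_mul (divd 4)
      (is_derive_add c1d (is_derive_opp tbd))).
have al_neq0 t : D t -> al t != 0.
  move=> /Dn0 t0; apply: mulf_neq0; [by rewrite pnatr_eq0|by rewrite invr_eq0].
have ga_neq0 t : D t -> ga t != 0.
  move=> /Dn0 t0; apply: mulf_neq0; last by rewrite invr_eq0.
  by rewrite oppr_eq0 pnatr_eq0.
exact: (linear_system_zeros_isolated Do Dc ad bd cd coefc al_neq0 ga_neq0 inv).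
Qed.

(** The off-diagonal entries y = 1 + b0 and w = c0 + c1 + t^2 are those of the
    residue at z = 1.  In these variables the equation for a0 is homogeneous because
    c0 - b0 c1 + t^2 b0^2 = w + (t^2 b0 - t^2 - c1) y. *)
Lemma b0_plus_1_zeros_isolated (R : realType) (D : set R[i])
    (a0 b0 c0 c1 : R[i] -> R[i]) (k : R[i]) :
  open D -> connected D -> (forall t, D t -> t != 0) ->
  (forall t, D t -> deformation_system a0 b0 c0 c1 t) ->
  (forall t, D t -> a0 t ^+ 2 + (1 + b0 t) * (c0 t + c1 t + t ^+ 2) = k) ->
  ~ (forall t, D t -> 1 + b0 t = 0) ->
  forall t0, D t0 -> \forall t \near t0^', 1 + b0 t != 0.
Proof.
move=> Do Dc Dn0 deq inv.
pose y t := 1 + b0 t; pose w t := c0 t + c1 t + t ^+ 2.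
pose al (t : R[i]) := 2 / t.
pose be t := 2 / t * (t ^+ 2 * b0 t - t ^+ 2 - c1 t).
pose ga (t : R[i]) := - 4 / t.
pose de t := 4 / t * (c1 t - t ^+ 2 * b0 t + t ^+ 2).
have ad t : D t -> is_derive t 1 a0 (al t * w t + be t * y t).
  move=> Dt; have [ad _ _ _] := deq t Dt; apply: (is_derive_eq ad).
  by rewrite /al /be /w /y -[X in _ = _ + X]mulrA -mulrDr; congr (_ * _); ring.
have yd t : D t -> is_derive t 1 y (ga t * a0 t).
  move=> /deq[_ bd _ _].
  by apply: (is_derive_eq (is_derive_add (is_derive_cst (1 : R[i]) t 1) bd)); rewrite add0r.
have wd t : D t -> is_derive t 1 w (de t * a0 t).
  move=> Dt; have [_ _ c0d c1d] := deq t Dt.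
  apply: (is_derive_eq (is_derive_add (is_derive_add c0d c1d)
    (is_derive_mul (is_derive_id t 1) (is_derive_id t 1)))).
  by rewrite mulr1 /de; field; exact: Dn0.
have coefc t : D t -> [/\ {for t, continuous al}, {for t, continuous be},
                        {for t, continuous ga} & {for t, continuous de}].
  move=> Dt; have [_ bd' _ c1d] := deq t Dt.
  have divd m := is_derive_mul (is_derive_cst m t 1)
    (is_derive_inv (Dn0 t Dt) (is_derive_id t 1)).
  have sqd := is_derive_mul (is_derive_id t 1) (is_derive_id t 1).
  have tbd := is_derive_mul sqd bd'.
  split.
  - exact: is_derive_continuous (divd 2).
  - exact: is_derive_continuous (is_derive_mul (divd 2) (is_derive_add
      (is_derive_add tbd (is_derive_opp sqd)) (is_derive_opp c1d))).
  - exact: is_derive_continuous (divd (- 4)).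
  - exact: is_derive_continuous (is_derive_mul (divd 4) (is_derive_add
      (is_derive_add c1d (is_derive_opp tbd)) sqd)).
have al_neq0 t : D t -> al t != 0.
  move=> /Dn0 t0; apply: mulf_neq0; [by rewrite pnatr_eq0|by rewrite invr_eq0].
have ga_neq0 t : D t -> ga t != 0.
  move=> /Dn0 t0; apply: mulf_neq0; last by rewrite invr_eq0.
  by rewrite oppr_eq0 pnatr_eq0.
exact: (linear_system_zeros_isolated Do Dc ad yd wd coefc al_neq0 ga_neq0 inv).
Qed.

(** * Rational identities behind the equations *)

(** The right-hand side of the equation for a0, with c0 and c1 eliminated by
    means of the two determinants. *)
Lemma momentum_derivative (F : numFieldType) (t a b c0 c1 k0 k1 : F) :
  b != 0 -> 1 + b != 0 ->
  a ^+ 2 + b * c0 = k0 -> a ^+ 2 + (1 + b) * (c0 + c1 + t ^+ 2) = k1 ->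
  c0 - b * c1 + t ^+ 2 * b ^+ 2 =
  (1 + b) * (k0 - a ^+ 2) / b - b * (k1 - a ^+ 2) / (1 + b)
  + t ^+ 2 * b * (1 + b).
Proof.
by move=> b0 b1 <- <-; field; rewrite b0 b1.
Qed.

(** The left-hand side is q'' = (4 a0 / t)' with a0' inserted, for q = - b. *)
Lemma degP5_algebra (F : numFieldType) (t a b th0 th1 : F) :
  t != 0 -> b != 0 -> 1 + b != 0 ->
  4 / t * (2 / t * ((1 + b) * (th0 ^+ 2 / 4 - a ^+ 2) / b
    - b * (th1 ^+ 2 / 4 - a ^+ 2) / (1 + b) + t ^+ 2 * b * (1 + b)))
  - 4 / t ^+ 2 * a =
  1 / 2 * (1 / (- b) + 1 / (- b - 1)) * (4 / t * a) ^+ 2 - 4 / t * a / t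
  + 2 * (- b - 1) * th0 ^+ 2 / (- b * t ^+ 2)
  - 2 * (- b) * th1 ^+ 2 / ((- b - 1) * t ^+ 2)
  + 8 * (- b) * (- b - 1).
Proof.
move=> t0 b0 b1.
have b2 : - b - 1 != 0 by rewrite -opprD oppr_eq0 addrC.
by field; rewrite ?oppr_eq0 ?t0 ?b0 ?b1 ?b2.
Qed.

Lemma canonical_q_algebra (F : numFieldType) (t a b : F) :
  t != 0 -> b != 0 -> 1 + b != 0 ->
  4 / t * a = - b * (1 - - b) * (4 * a / (t * - b) - 4 * a / (t * (- b - 1))).
Proof.
move=> t0 b0 b1.
have b2 : - b - 1 != 0 by rewrite -opprD oppr_eq0 addrC.
by field; rewrite ?oppr_eq0 ?t0 ?b0 ?b1 ?b2.
Qed.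

Lemma canonical_p_algebra (F : numFieldType) (t a b k0 k1 : F) :
  t != 0 -> b != 0 -> 1 + b != 0 ->
  2 / t * ((1 + b) * (k0 - a ^+ 2) / b - b * (k1 - a ^+ 2) / (1 + b)
    + t ^+ 2 * b * (1 + b)) =
  - - b * (1 - - b) * (- (2 * (a ^+ 2 - k0) * t / (t * - b) ^+ 2)
    + 2 * (a ^+ 2 - k1) * t / (t * (- b - 1)) ^+ 2 + 2 * t).
Proof.
move=> t0 b0 b1.
have b2 : - b - 1 != 0 by rewrite -opprD oppr_eq0 addrC.
by field; rewrite ?oppr_eq0 ?t0 ?b0 ?b1 ?b2.
Qed.

(** * The Hamiltonian system *)

Section Hamiltonian.
Variables (R : realType) (th0 th1 : R[i]).

Lemma hamiltonian_derive_p (t q p : R[i]) :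
  derive1 (fun y => hamiltonian th0 th1 t q y) p =
  4 * p / (t * q) - 4 * p / (t * (q - 1)).
Proof.
have sq c : is_derive p 1 (fun y : R[i] => y ^+ 2 - c) (p + p).
  apply: (is_derive_eq (is_derive_add (is_derive_mul (is_derive_id p 1)
    (is_derive_id p 1)) (is_derive_cst (- c) p 1))).
  by rewrite !mulr1 addr0.
have term c k : is_derive p 1 (fun y : R[i] => 2 * (y ^+ 2 - c) / k) (4 * p / k).
  apply: (is_derive_eq (is_derive_mul (is_derive_mul (is_derive_cst (2 : R[i]) p 1)
    (sq c)) (is_derive_cst k^-1 p 1))).
  rewrite !mulr0 addr0 add0r mulrC; congr (_ * _).
  by rewrite mulrDr -mulrDl -natrD.
have Hd := is_derive_add (is_derive_add (term (th0 ^+ 2 / 4) (t * q))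
  (is_derive_opp (term (th1 ^+ 2 / 4) (t * (q - 1)))))
  (is_derive_cst (2 * q * t) p 1).
by rewrite (is_derive1 Hd) addr0.
Qed.

Lemma hamiltonian_derive_q (t q p : R[i]) :
  t != 0 -> q != 0 -> q - 1 != 0 ->
  derive1 (fun x => hamiltonian th0 th1 t x p) q =
  - (2 * (p ^+ 2 - th0 ^+ 2 / 4) * t / (t * q) ^+ 2)
  + 2 * (p ^+ 2 - th1 ^+ 2 / 4) * t / (t * (q - 1)) ^+ 2 + 2 * t.
Proof.
move=> t0 q0 q1.
have lin c : is_derive q 1 (fun x : R[i] => t * (x - c)) t.
  apply: (is_derive_eq (is_derive_mul (is_derive_cst t q 1)
    (is_derive_add (is_derive_id q 1) (is_derive_cst (- c) q 1)))).
  by rewrite mulr0 !addr0 mulr1.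
have lin0 : is_derive q 1 (fun x : R[i] => t * x) t.
  apply: (is_derive_eq (is_derive_mul (is_derive_cst t q 1) (is_derive_id q 1))).
  by rewrite mulr0 !addr0 mulr1.
have term k (f : R[i] -> R[i]) : f q != 0 -> is_derive q 1 f t ->
    is_derive q 1 (fun x => k / f x) (- (k * t / f q ^+ 2)).
  move=> f0 fd; apply: (is_derive_eq (is_derive_mul (is_derive_cst k q 1)
    (is_derive_inv f0 fd))).
  by rewrite mulr0 addr0 mulNr mulrN -mulrA [t / _]mulrC.
have tq0 : t * q != 0 by rewrite mulf_neq0.
have tq1 : t * (q - 1) != 0 by rewrite mulf_neq0.
have drift : is_derive q 1 (fun x : R[i] => 2 * x * t) (2 * t).
  apply: (is_derive_eq (is_derive_mul (is_derive_mul (is_derive_cst (2 : R[i]) q 1)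
    (is_derive_id q 1)) (is_derive_cst t q 1))).
  by rewrite !mulr0 mulr1 add0r addr0 mulrC.
have Hd := is_derive_add (is_derive_add
  (term (2 * (p ^+ 2 - th0 ^+ 2 / 4)) _ tq0 lin0)
  (is_derive_opp (term (2 * (p ^+ 2 - th1 ^+ 2 / 4)) _ tq1 (lin 1)))) drift.
by rewrite (is_derive1 Hd) opprK.
Qed.
End Hamiltonian.

Theorem mainTheorem3 (R : realType) (theta0 theta1 : R[i]) (D : set R[i])
    (a0 b0 c0 c1 : R[i] -> R[i]) :
  open D -> connected D -> (forall t, D t -> t != 0) ->
  holomorphic D a0 -> holomorphic D b0 ->
  holomorphic D c0 -> holomorphic D c1 ->
  (forall t, D t -> a0 t ^+ 2 + b0 t * c0 t = theta0 ^+ 2 / 4) ->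
  (forall t, D t ->
     a0 t ^+ 2 + (1 + b0 t) * (c0 t + c1 t + t ^+ 2) = theta1 ^+ 2 / 4) ->
  isomonodromic D (connection a0 b0 c0 c1) ->
  let q : R[i] -> R[i] := fun t => - b0 t in
  ~ (forall t, D t -> q t = 0) ->
  ~ (forall t, D t -> q t = 1) ->
  let p : R[i] -> R[i] := fun t => t / 4 * derive1 q t in
  let H := hamiltonian theta0 theta1 in
  [/\ meromorphic_eq D (derive1 (derive1 q))
        (fun t => 1 / 2 * (1 / q t + 1 / (q t - 1)) * derive1 q t ^+ 2
                  - derive1 q t / t
                  + 2 * (q t - 1) * theta0 ^+ 2 / (q t * t ^+ 2)
                  - 2 * q t * theta1 ^+ 2 / ((q t - 1) * t ^+ 2)
                  + 8 * q t * (q t - 1)),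
      meromorphic_eq D (derive1 q)
        (fun t => q t * (1 - q t) * derive1 (fun y => H t (q t) y) (p t)) &
      meromorphic_eq D (derive1 p)
        (fun t => - q t * (1 - q t) * derive1 (fun x => H t x (p t)) (q t))].
Proof.
move=> Do Dc Dn0 ha hb hc0 hc1 inv0 inv1 iso q qn0 qn1 p H.
have deq := isomonodromic_deformation_system Dn0 ha hb hc0 hc1 iso.
have b_n0 := b0_zeros_isolated Do Dc Dn0 deq inv0.
have b_n1 := b0_plus_1_zeros_isolated Do Dc Dn0 deq inv1.
have {}b_n0 t0 : D t0 -> \forall t \near t0^', b0 t != 0.
  by apply: b_n0 => b0E; apply: qn0 => t Dt; rewrite /q b0E // oppr0.
have {}b_n1 t0 : D t0 -> \forall t \near t0^', 1 + b0 t != 0.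
  apply: b_n1 => b1E; apply: qn1 => t Dt; rewrite /q.
  by apply/esym/eqP; rewrite -addr_eq0 b1E.
have dq t : D t -> derive1 q t = 4 / t * a0 t.
  move=> Dt; have [_ bd _ _] := deq t Dt.
  by rewrite (is_derive1 (is_derive_opp bd)) !mulNr opprK.
have pE t : D t -> p t = a0 t.
  move=> Dt; rewrite /p dq // mulrA -[LHS]mul1r.
  by field; rewrite Dn0.
have nearD t : D t -> \forall s \near t, D s by move=> Dt; exact: open_nbhs_nbhs.
pose W t := 2 / t * ((1 + b0 t) * (theta0 ^+ 2 / 4 - a0 t ^+ 2) / b0 t
    - b0 t * (theta1 ^+ 2 / 4 - a0 t ^+ 2) / (1 + b0 t)
    + t ^+ 2 * b0 t * (1 + b0 t)).
have ad t : D t -> b0 t != 0 -> 1 + b0 t != 0 -> is_derive t 1 a0 (W t).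
  move=> Dt n0 n1; have [ad _ _ _] := deq t Dt.
  by apply: (is_derive_eq ad); rewrite (momentum_derivative n0 n1 (inv0 t Dt) (inv1 t Dt)).
have generic (P : R[i] -> Prop) :
    (forall t, D t -> b0 t != 0 -> 1 + b0 t != 0 -> P t) ->
    forall t0, D t0 -> \forall t \near t0^', P t.
  move=> PP t0 Dt0.
  by apply: filterS3 (nbhs_dnbhs (nearD t0 Dt0)) (b_n0 t0 Dt0) (b_n1 t0 Dt0).
split; apply: generic => t Dt n0 n1; have t0 := Dn0 t Dt.
- rewrite dq // -degP5_algebra // -/(W t).
  rewrite (@near_derive1 _ _ (fun s => 4 / s * a0 s)); last first.
    by apply: filterS (nearD t Dt) => s /dq.
  have fourd : is_derive t 1 (fun s : R[i] => 4 / s) (- 4 / t ^+ 2).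
    apply: (is_derive_eq (is_derive_mul (is_derive_cst (4 : R[i]) t 1)
      (is_derive_inv t0 (is_derive_id t 1)))).
    by rewrite mulr0 addr0 mulr1 mulrN mulNr.
  rewrite (is_derive1 (is_derive_mul fourd (ad t Dt n0 n1))).
  by rewrite mulNr mulrN [a0 t * _]mulrC.
- by rewrite dq // pE // hamiltonian_derive_p; exact: canonical_q_algebra.
- rewrite pE // hamiltonian_derive_q ?oppr_eq0 //; last first.
    by rewrite -opprD oppr_eq0 addrC.
  rewrite -canonical_p_algebra // -/(W t).
  rewrite (@near_derive1 _ _ a0); last by apply: filterS (nearD t Dt) => s /pE.
  exact: is_derive1 (ad t Dt n0 n1).
Qed.
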